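(* For integers $0\le k\le n$, let $p(n,k)$ be the probability that a given vertex at level $k$ wins the game Pass the Buck on the complete binary tree of level $n$ with the buck starting at the root. For integers $m\ge 0$ put $$a(m)=\frac12\left(\left(2-\sqrt2\right)^m+\left(2+\sqrt2\right)^m\right),\qquad t(m)=\frac{\left(2+\sqrt2\right)^{m+1}-\left(2-\sqrt2\right)^{m+1}}{2\sqrt2}.$$ Then for all $0\le k\le n$, $$p(n,k)=\frac{a(n-k)}{t(n)};$$ in particular, the probability that the root wins is $$p(n,0)=\frac{a(n)}{t(n)}=\frac{\sqrt2\left(\left(2-\sqrt2\right)^n+\left(2+\sqrt2\right)^n\right)}{\left(2+\sqrt2\right)^{n+1}-\left(2-\sqrt2\right)^{n+1}}.$$ Moreover, $\lim_{n\to\infty}p(n,0)=\sqrt2-1$, and more generally, for every fixed $k\ge 0$, $$\lim_{n\to\infty}p(n,k)=\frac{\sqrt2}{\left(2+\sqrt2\right)^{k+1}}.$$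
   Context: Complete binary tree of level $n$ ($n\ge 0$): the rooted tree in which the root is at level $0$, every vertex at a level $<n$ has exactly two children, and the vertices at level $n$ are leaves; level $n=0$ is a single vertex. It has $2^k$ vertices at level $k$, $0\le k\le n$. Pass the Buck is played on a finite connected undirected graph with a distinguished start vertex, which initially holds the buck. At each step, if the vertex $v$ currently holding the buck has degree $d$, then, independently of the past, with probability $\frac1{d+1}$ the game ends and $v$ wins, and for each neighbor $w$ of $v$, with probability $\frac1{d+1}$ the buck is passed to $w$ and the game continues from there. *)

(* Defs.v *)
From HB Require Import structures.
From mathcomp Require Import all_boot all_order all_algebra.
From mathcomp Require Import all_classical all_reals all_analysis.

Set Implicit Arguments.
Unset Strict Implicit.
Unset Printing Implicit Defensive.

Import Order.TTheory GRing.Theory Num.Theory.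
Import numFieldNormedType.Exports.

Local Open Scope classical_set_scope.
Local Open Scope ring_scope.

(* A graph on the finite vertex type [T] is given by its adjacency relation,
   meant to be symmetric and irreflexive. *)

Definition degree (T : finType) (adj : rel T) (v : T) : nat :=
  #|[set w | adj v w]%SET|.

(* [inl v]: the game is still running and [v] holds the buck;
   [inr v]: the game is over and [v] has won. *)
Definition state (T : finType) : finType := (T + T)%type.

(* One-step transition probabilities; finished games stay as they are. *)
Definition step_prob (R : realType) (T : finType) (adj : rel T)
    (x y : state T) : R :=
  match x, y with
  | inl v, inl w => if adj v w then ((degree adj v).+1%:R)^-1 else 0
  | inl v, inr w => if w == v then ((degree adj v).+1%:R)^-1 else 0
  | inr _, inl _ => 0
  | inr v, inr w => if w == v then 1 else 0
  end.

Lemma sum_step_prob (R : realType) (T : finType) (adj : rel T) (x : state T) :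
  \sum_(y : state T) step_prob R adj x y = 1.
Proof.
rewrite big_sumType /=; case: x => v /=; last first.
  by rewrite big1 // add0r -big_mkcond big_pred1_eq.
rewrite -!big_mkcond big_pred1_eq /= sumr_const.
have -> : #|(fun w => adj v w) : pred T| = degree adj v.
  by apply: eq_card => w; rewrite inE.
by rewrite -mulrSr -[LHS]mulr_natr mulVf // pnatr_eq0.
Qed.

Definition follows (T : finType) (Omega : Type) (X : nat -> Omega -> state T)
    (h : nat -> state T) (m : nat) : set Omega :=
  [set omega | forall i, (i <= m)%N -> X i omega = h i].

(* The process [X] on the probability space [(Omega, P)] is a play of the game.
   [play_step] says that, given any possible history up to time [m], the state
   at time [m.+1] is drawn according to [step_prob] from the state at time [m];
   the product form avoids conditioning on null events. *)
Record is_play (R : realType) (T : finType) (adj : rel T) (start : T)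
    (d : measure_display) (Omega : measurableType d) (P : probability Omega R)
    (X : nat -> Omega -> state T) : Prop := IsPlay {
  play_measurable : forall i x, measurable (X i @^-1` [set x]);
  play_start : P (X 0%N @^-1` [set inl start]) = 1%E;
  play_step : forall (h : nat -> state T) (m : nat),
    (P (follows X h m.+1) =
      P (follows X h m) * (step_prob R adj (h m) (h m.+1))%:E)%E
}.

Definition wins (T : finType) (Omega : Type) (X : nat -> Omega -> state T)
    (v : T) : set Omega :=
  [set omega | exists i, X i omega = inr v].

Definition win_prob (R : realType) (T : finType)
    (d : measure_display) (Omega : measurableType d) (P : probability Omega R)
    (X : nat -> Omega -> state T) (v : T) : R :=
  fine (P (wins X v)).

(* A vertex of the complete binary tree of level [n] is the sequence of
   left/right turns on the way from the root to it, so its level is the length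
   of the sequence; the children of [u] are [rcons u false] and [rcons u true],
   which have length at most [n] exactly when [u] has level less than [n]. *)

Definition tree_vertex (n : nat) : finType := n.-bseq bool.

Definition tree_level (n : nat) (v : tree_vertex n) : nat := size v.

Definition tree_root (n : nat) : tree_vertex n := [bseq].

Definition tree_child (n : nat) (u v : tree_vertex n) : bool :=
  [exists b : bool, (v : seq bool) == rcons u b].

Definition tree_adj (n : nat) : rel (tree_vertex n) :=
  fun u v => tree_child u v || tree_child v u.

Lemma tree_adj_sym (n : nat) : symmetric (@tree_adj n).
Proof. by move=> u v; rewrite /tree_adj orbC. Qed.

Lemma tree_adj_irr (n : nat) : irreflexive (@tree_adj n).
Proof.
move=> u; rewrite /tree_adj orbb; apply/existsP => -[b /eqP /(congr1 size)].
by rewrite size_rcons => /eqP; rewrite ltn_eqF.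
Qed.

Lemma tree_connected (n : nat) (u v : tree_vertex n) :
  connect (@tree_adj n) u v.
Proof.
have root_conn (w : tree_vertex n) : connect (@tree_adj n) (tree_root n) w.
  case: w => s; elim/last_ind: s => [|s b IHs] le_s.
    by rewrite (_ : Bseq le_s = tree_root n) //; apply: val_inj.
  have le_s' : (size s <= n)%N by rewrite (leq_trans _ le_s) // size_rcons.
  apply: connect_trans (IHs le_s') (connect1 _).
  by apply/orP; left; apply/existsP; exists b.
by apply: connect_trans (root_conn v); rewrite (sym_connect_sym (@tree_adj_sym n)).
Qed.

Definition seq_a (R : realType) (m : nat) : R :=
  2^-1 * ((2 - Num.sqrt 2) ^+ m + (2 + Num.sqrt 2) ^+ m).

Definition seq_t (R : realType) (m : nat) : R :=
  ((2 + Num.sqrt 2) ^+ m.+1 - (2 - Num.sqrt 2) ^+ m.+1) / (2 * Num.sqrt 2).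

(* Main.v *)
(* The expected number of visits to v is (deg v + 1) times the probability w(v)
   that v wins, and every visit after time 0 comes from a neighbour u, which
   passes the buck to v exactly as often as it wins. Hence w solves
     (deg v + 1) w(v) = [v = start] + sum of w(u) over the neighbours u of v.
   By a maximum principle this linear system has at most one solution, and
   a(n-k)/t(n) solves it on the tree, because 2 + sqrt 2 and 2 - sqrt 2 are the
   roots of x^2 = 4 x - 2. *)

Require Import Defs.
From HB Require Import structures.
From mathcomp Require Import all_boot all_order all_algebra.
From mathcomp Require Import all_classical all_reals all_analysis.
From mathcomp Require Import zify ring lra.

Import Order.TTheory GRing.Theory Num.Theory.
Import numFieldNormedType.Exports.

Local Open Scope classical_set_scope.
Local Open Scope ring_scope.

(** * The game as a Markov chain on a finite graph *)

Lemma measure_finite_partition (R : realType) (d : measure_display)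
    (Omega : measurableType d) (mu : {measure set Omega -> \bar R})
    (I : finType) (Y : Omega -> I) (A : set Omega) :
  measurable A -> (forall i, measurable (Y @^-1` [set i])) ->
  mu A = (\sum_(i : I) mu (A `&` Y @^-1` [set i]))%E.
Proof.
move=> mA mY.
rewrite fsbig_seq ?index_enum_uniq //.
rewrite -measure_fin_bigcup //.
- congr (mu _); apply/seteqP; split => [w Aw | w [i _ []] //].
  by exists (Y w); rewrite //= mem_index_enum.
- by move=> i j _ _ [w [[_ <-] [_ <-]]].
- by move=> i _; apply: measurableI.
Qed.

Section Play.
Variables (R : realType) (T : finType) (adj : rel T) (start : T).
Variables (d : measure_display) (Omega : measurableType d).
Variables (P : probability Omega R) (X : nat -> Omega -> state T).
Hypothesis play : is_play adj start P X.

Let measurable_at i x : measurable (X i @^-1` [set x]).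
Proof. exact: (play_measurable play). Qed.

(** The case [j = 0] is [follows]; the lower end [j] makes it possible to forget the past step by
    step. *)
Let window (h : nat -> state T) (j m : nat) : set Omega :=
  [set w | forall i, (j <= i <= m)%N -> X i w = h i].

Lemma measurable_window h j m : measurable (window h j m).
Proof.
rewrite (_ : window h j m =
  \bigcap_(i in [set i | (j <= i <= m)%N]) X i @^-1` [set h i]).
  by apply: bigcap_measurableType => i _.
by apply/seteqP; split.
Qed.

(* Dropping the earliest state of the history, one time at a time, turns
   [play_step] into the Markov property at a single time. *)
Lemma window_step h j m : (j <= m)%N ->
  (P (window h j m.+1) = P (window h j m) * (step_prob R adj (h m) (h m.+1))%:E)%E.
Proof.
elim: j h => [|j IHj] h le_jm.
  exact: (play_step play).
have split_at m' : (j < m')%N -> P (window h j.+1 m') =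
    (\sum_(x : state T) P (window (fun i => if i == j then x else h i) j m'))%E.
  move=> lt_jm'.
  rewrite (@measure_finite_partition _ _ _ P _ (X j)) //; last exact: measurable_window.
  apply: eq_bigr => x _; congr (P _); apply/seteqP; split=> w /=.
    move=> [Hw Xj] i /andP[le_ji le_im].
    have [-> //|ne_ij] := eqVneq i j.
    by apply: Hw; rewrite le_im ltn_neqAle eq_sym ne_ij le_ji.
  move=> Hw; split; last first.
    by have := Hw j; rewrite eqxx leqnn ltnW // => /(_ isT).
  move=> i /andP[lt_ji le_im]; have := Hw i.
  by rewrite gtn_eqF // le_im ltnW // => /(_ isT).
rewrite !split_at //; last by rewrite ltnS ltnW.
rewrite ge0_sume_distrl; last by move=> x _; apply: measure_ge0.
apply: eq_bigr => x _; rewrite IHj 1?ltnW //.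
(* Overriding [h] at time [j] leaves the step factor alone, which only reads [h] at the later times
   [m] and [m.+1]. *)
by rewrite !gtn_eqF // ltnS ltnW.
Qed.

Lemma prob_two_step m x y :
  (P (X m @^-1` [set x] `&` X m.+1 @^-1` [set y]) =
   P (X m @^-1` [set x]) * (step_prob R adj x y)%:E)%E.
Proof.
have := @window_step (fun i => if i == m then x else y) m m (leqnn m).
rewrite eqxx gtn_eqF // => E; rewrite -[X in (_ = P X * _)%E](_ : window
  (fun i => if i == m then x else y) m m = _); last first.
  apply/seteqP; split => w /=.
    by move=> /(_ m); rewrite eqxx leqnn => /(_ isT).
  by move=> Xm i; rewrite -eqn_leq => /eqP <-; rewrite eqxx.
rewrite -E; congr (P _); apply/seteqP; split => w /=.
  move=> [Xm XSm] i /andP[le_mi]; rewrite leq_eqVlt ltnS => /orP[/eqP ->|le_im].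
    by rewrite gtn_eqF.
  by rewrite (_ : i = m) ?eqxx //; apply/eqP; rewrite eqn_leq le_im.
move=> Hw; split.
  by have := Hw m; rewrite eqxx leqnn leqnSn => /(_ isT).
by have := Hw m.+1; rewrite gtn_eqF // leqnn leqnSn => /(_ isT).
Qed.

Definition law m x : R := fine (P (X m @^-1` [set x])).

Lemma law0 x : law 0 x = (x == inl start)%:R.
Proof.
have E := play_start play.
rewrite /law; have [->|ne_x] := eqVneq x (inl start); first by rewrite E.
suff -> : P (X 0%N @^-1` [set x]) = 0%E by [].
apply: (@subset_measure0 _ _ _ P _ (~` (X 0%N @^-1` [set inl start]))) => //.
- exact: measurableC.
- by move=> w /= -> /eqP; apply/negP.
- by have := probability_setC P (measurable_at 0 (inl start)); rewrite E subee.
Qed.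

Lemma lawS m y : law m.+1 y = \sum_(x : state T) law m x * step_prob R adj x y.
Proof.
rewrite /law (@measure_finite_partition _ _ _ P _ (X m)) //.
rewrite -sum_fine; last by move=> x _; apply: fin_num_measure; apply: measurableI.
apply: eq_bigr => x _; rewrite setIC (congr1 fine (prob_two_step m x y)) fineM //.
exact: fin_num_measure.
Qed.

Lemma law_inrS m v :
  law m.+1 (inr v) = law m (inr v) + law m (inl v) / (degree adj v).+1%:R.
Proof.
rewrite lawS big_sumType /= addrC; congr (_ + _).
  rewrite (bigD1 v) //= eqxx mulr1 big1 ?addr0 // => u ne_uv.
  by rewrite eq_sym (negPf ne_uv) mulr0.
rewrite (bigD1 v) //= eqxx big1 ?addr0 // => u ne_uv.
by rewrite eq_sym (negPf ne_uv) mulr0.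
Qed.

Lemma law_inlS m v :
  law m.+1 (inl v) = \sum_(u | adj u v) law m (inl u) / (degree adj u).+1%:R.
Proof.
rewrite lawS big_sumType /= [X in _ + X]big1 ?addr0; last first.
  by move=> u _; rewrite mulr0.
by rewrite [RHS]big_mkcond; apply: eq_bigr => u _; case: ifP; rewrite ?mulr0.
Qed.

(* [(deg v + 1) P(v has won by time m + 1)] is the expected number of visits
   to [v] up to time [m]. *)
Lemma law_win_balance m v :
  (degree adj v).+1%:R * law m.+1 (inr v) =
  (v == start)%:R + \sum_(u | adj u v) law m (inr u).
Proof.
have deg_neq0 u : (degree adj u).+1%:R != 0 :> R by rewrite pnatr_eq0.
elim: m => [|m IHm].
  rewrite law_inrS !law0 add0r mulrC divfK //.
  rewrite big1 ?addr0 // => u _; exact: law0.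
(* The increment on the left is the probability that [v] holds the buck at time [m.+1]. By
   [law_inlS] it is the sum of the increments of the neighbours' winning probabilities, since a
   holder passes to [v] as likely as it wins. *)
rewrite law_inrS mulrDr IHm [_ * (_ / _)]mulrC divfK // law_inlS -addrA.
by rewrite -big_split /=; under [in RHS]eq_bigr do rewrite law_inrS.
Qed.

Let won_by v m : set Omega := \bigcup_(i in [set i | (i <= m)%N]) X i @^-1` [set inr v].

Let measurable_won_by v m : measurable (won_by v m).
Proof. by apply: bigcup_measurable => i _. Qed.

Lemma won_by_absorbed v m : P (won_by v m `\` X m @^-1` [set inr v]) = 0%E.
Proof.
elim: m => [|m IHm].
  rewrite (_ : _ `\` _ = set0) ?measure0 //.
  by apply/seteqP; split => // w [[i]] /=; rewrite leqn0 => /eqP ->.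
have leave0 : P (X m @^-1` [set inr v] `\` X m.+1 @^-1` [set inr v]) = 0%E.
  have stay : P (X m @^-1` [set inr v] `&` X m.+1 @^-1` [set inr v]) =
      P (X m @^-1` [set inr v]) by rewrite prob_two_step /= eqxx mule1.
  rewrite measureD //; last by rewrite ltey_eq fin_num_measure.
  by rewrite [X in (_ - X)%E]stay; apply: subee; apply: fin_num_measure.
have mD A B : measurable A -> measurable B -> measurable (A `\` B :> set Omega).
  exact: measurableD.
apply: (subset_measure0 _ _ _ (null_set_setU (mD _ _ _ _) (mD _ _ _ _) IHm leave0)) => //.
- exact: mD.
- by apply: measurableU; apply: mD.
- move=> w [[i /=]]; rewrite leq_eqVlt ltnS => /orP[/eqP -> //|le_im Xi XSm].
  have [Xm|Xm] := pselect (X m w = inr v); first by right.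
  by left; split => //; exists i.
Qed.

(** Up to a null event, being in [inr v] at time [m] is [won_by v m]. These events increase to
    [wins X v], so continuity from below applies. *)
Lemma cvg_law_win v : law m (inr v) @[m --> \oo] --> win_prob P X v.
Proof.
have PW m : P (won_by v m) = P (X m @^-1` [set inr v]).
  have := won_by_absorbed v m; set D := (X in P X) => D0.
  rewrite -[RHS](@measureU0 _ _ _ P _ D) //; last exact: measurableD.
  congr (P _); apply/seteqP; split => w.
    move=> Ww; have [?|?] := pselect (X m w = inr v); [by left | by right].
  by case => [Xm|[]//]; exists m => /=.
have -> : law ^~ (inr v) = fine \o (P \o won_by v).
  by apply/funext => m; rewrite /law /= PW.
rewrite /win_prob (_ : wins X v = \bigcup_m won_by v m); last first.
  apply/seteqP; split => w; first by case=> i Xi; exists i => //; exists i => /=.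
  by case=> m _ [i _ Xi]; exists i.
apply: fine_cvg; rewrite fineK; last first.
  by apply: fin_num_measure; apply: bigcup_measurable.
apply: nondecreasing_cvg_mu => //; first exact: bigcup_measurable.
move=> m m' le_mm'; apply/subsetPset => w [i /= le_im Xi].
by exists i => //=; apply: leq_trans le_mm'.
Qed.

(** Limit of [law_win_balance] as the time tends to infinity. *)
Lemma win_prob_balance v :
  (degree adj v).+1%:R * win_prob P X v =
  (v == start)%:R + \sum_(u | adj u v) win_prob P X u.
Proof.
have lhs : (degree adj v).+1%:R * law m.+1 (inr v) @[m --> \oo] -->
    (degree adj v).+1%:R * win_prob P X v.
  by apply: cvgMr; rewrite (cvg_shiftS (fun m => law m (inr v))); apply: cvg_law_win.
have rhs : (v == start)%:R + \sum_(u | adj u v) law m (inr u) @[m --> \oo] -->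
    (v == start)%:R + \sum_(u | adj u v) win_prob P X u.
  apply: cvgD; first exact: cvg_cst.
  by apply: cvg_big; [exact: add_continuous|move=> u _; apply: cvg_law_win].
apply: cvg_unique lhs _; first exact: Rhausdorff.
by move: rhs; under eq_fun do rewrite -law_win_balance.
Qed.

End Play.

(* Maximum principle: [deg + 1] neighbours would be needed to balance [g] at a
   vertex where [|g|] is largest. *)
Lemma balanced_eq0 (R : realType) (T : finType) (adj : rel T) (g : T -> R) :
  symmetric adj ->
  (forall v, (degree adj v).+1%:R * g v = \sum_(u | adj u v) g u) ->
  forall v, g v = 0.
Proof.
move=> adj_sym g_bal v0.
case: (@Order.TotalTheory.arg_maxP _ _ _ v0 xpredT (fun v => `|g v|)) => // v _ g_max.
have le_deg : (degree adj v).+1%:R * `|g v| <= (degree adj v)%:R * `|g v|.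
  rewrite -[X in X * _ <= _]ger0_norm // -normrM g_bal (le_trans (ler_norm_sum _ _ _)) //.
  (* [degree] counts the [w] with [adj v w], the sum runs over the [u] with [adj u v]; symmetry
     identifies the two sets. *)
  rewrite mulr_natl (_ : degree adj v = #|(fun u => adj u v) : pred T|); last first.
    by apply: eq_card => u; rewrite inE adj_sym.
  by rewrite -sumr_const; apply: ler_sum => u _; apply: g_max.
have gv0 : `|g v| <= 0 by move: le_deg; rewrite -natr1 mulrDl mul1r gerDl.
by apply/normr0_eq0/le_anti; rewrite normr_ge0 (le_trans (g_max v0 _)).
Qed.

(** * Neighbours and degrees in the complete binary tree *)

Lemma sum_tree_adj (V : nmodType) (n : nat) (F : nat -> V) (v : tree_vertex n) :
  \sum_(u : tree_vertex n | tree_adj u v) F (tree_level u) =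
  (if (tree_level v < n)%N then F (tree_level v).+1 *+ 2 else 0) +
  (if (0 < tree_level v)%N then F (tree_level v).-1 else 0).
Proof.
have child_size (u w : tree_vertex n) : tree_child u w -> size w = (size u).+1.
  by move=> /existsP[b /eqP ->]; rewrite size_rcons.
rewrite (bigID (fun u : tree_vertex n => tree_child v u)) /=; congr (_ + _).
  rewrite (eq_bigl (fun u => tree_child v u)); last first.
    by move=> u; rewrite /tree_adj andb_orl andbb orb_idl // => /andP[].
  rewrite /tree_level; case: ltnP => [lt_vn | le_nv]; last first.
    apply: big_pred0 => u; apply/negbTE/negP => /child_size su.
    by have := size_bseq u; rewrite su ltnNge le_nv.
  have le_child b : (size (rcons v b) <= n)%N by rewrite size_rcons.
  (* A child is determined by its last turn; being nonempty, it never meets the default [false] of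
     [last]. *)
  rewrite (reindex_onto (fun b : bool => Bseq (le_child b) : tree_vertex n)
    (fun u => last false u)) /=; last first.
    move=> u /existsP[b /eqP uE]; apply: val_inj => /=.
    by rewrite uE last_rcons.
  rewrite (eq_bigl xpredT); last first.
    move=> b; rewrite last_rcons eqxx andbT; apply/existsP; by exists b.
  by rewrite big_bool /= !size_rcons.
(* The remaining neighbours are parents of [v]: by levels, no vertex is both child and parent of
   [v]. *)
rewrite (eq_bigl (fun u => tree_child u v)); last first.
  move=> u; rewrite /tree_adj; case uv: (tree_child u v) => /=; last first.
    by case: (tree_child v u).
  apply/negP => /child_size; rewrite (child_size _ _ uv) => /eqP.
  by rewrite ltn_eqF // leqW.
rewrite /tree_level; case: v => v; case/lastP: v => [|s b] le_v /=.
  by rewrite big_pred0 // => u; apply/negbTE/negP => /child_size.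
have le_s : (size s <= n)%N by rewrite (leq_trans _ le_v) // size_rcons.
rewrite size_rcons /= (big_pred1 (Bseq le_s : tree_vertex n)) // => u.
apply/existsP/eqP => [[c /eqP /=] | ->]; last by exists b.
by move=> /rcons_inj[su _]; apply: val_inj.
Qed.

(** The degree is the neighbour sum of the constant 1. *)
Lemma degree_tree (n : nat) (v : tree_vertex n) :
  degree (@tree_adj n) v =
  ((if (tree_level v < n)%N then 2 else 0) + (0 < tree_level v))%N.
Proof.
apply/eqP; rewrite -(eqr_nat rat) natrD; apply/eqP.
rewrite [LHS](_ : _ = \sum_(u : tree_vertex n | tree_adj u v) 1); last first.
  rewrite sumr_const; congr _%:R.
  by apply: eq_card => u; rewrite !inE [RHS]tree_adj_sym.
by rewrite (@sum_tree_adj rat n (fun=> 1) v); case: ltnP => _; case: ltnP.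
Qed.

(** * The sequences [seq_a] and [seq_t] *)

Section Sequences.
Variable R : realType.
Let s : R := Num.sqrt 2.

Lemma sqr_sqrt2 : s * s = 2.
Proof. by rewrite -expr2 sqr_sqrtr. Qed.

Lemma sqrt2_gt1 : 1 < s.
Proof. by have := sqr_sqrt2; have : 0 <= s := sqrtr_ge0 _; nra. Qed.

Lemma sqrt2_lt2 : s < 2.
Proof. by have := sqr_sqrt2; have := sqrt2_gt1; nra. Qed.

Lemma seq_a0 : seq_a R 0 = 1.
Proof. by rewrite /seq_a !expr0; lra. Qed.

Lemma seq_a1 : seq_a R 1 = 2.
Proof. by rewrite /seq_a !expr1; lra. Qed.

Lemma seq_aSS m : seq_a R m.+2 + 2 * seq_a R m = 4 * seq_a R m.+1.
Proof.
rewrite /seq_a !exprS -/s; have := sqr_sqrt2.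
by move: (_ ^+ m) ((2 + s) ^+ m) => x y s2; ring: s2.
Qed.

Lemma seq_t0 : seq_t R 0 = 1.
Proof.
rewrite /seq_t -/s !expr1; have := sqrt2_gt1 => s1.
by field; rewrite gt_eqF // (lt_trans ltr01).
Qed.

(** This is the balance equation at the root of a tree of level [m.+1], where the root has degree
    2. *)
Lemma seq_t_eq_a m : seq_t R m.+1 = 3 * seq_a R m.+1 - 2 * seq_a R m.
Proof.
rewrite /seq_a /seq_t !exprS -/s; have := sqr_sqrt2; have := sqrt2_gt1.
move: (_ ^+ m) ((2 + s) ^+ m) => x y s1 s2.
by field: s2; rewrite gt_eqF // (lt_trans ltr01).
Qed.

Lemma seq_t_gt0 m : 0 < seq_t R m.
Proof.
have := sqrt2_gt1 => s1; have := sqrt2_lt2 => s2.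
rewrite /seq_t -/s divr_gt0 //; last by lra.
by rewrite subr_gt0 ltrXn2r //=; lra.
Qed.

Lemma seq_a_div_t n : seq_a R n / seq_t R n =
  s * ((2 - s) ^+ n + (2 + s) ^+ n) / ((2 + s) ^+ n.+1 - (2 - s) ^+ n.+1).
Proof.
have := sqrt2_gt1 => s1.
have : (2 + s) ^+ n.+1 - (2 - s) ^+ n.+1 != 0.
  have := seq_t_gt0 n; rewrite /seq_t -/s pmulr_lgt0 ?invr_gt0; last lra.
  by move/lt0r_neq0.
rewrite /seq_a /seq_t -/s.
set t := _ - _; set a := _ + _ => t0.
by field; rewrite t0 gt_eqF //; lra.
Qed.

(** Dividing numerator and denominator by the dominant power [b ^+ n] leaves only powers of
    [r = a / b], which lies strictly between 0 and 1. *)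
Lemma cvg_seq_a_div_t k :
  seq_a R n / seq_t R (n + k) @[n --> \oo] --> s / (2 + s) ^+ k.+1.
Proof.
have := sqrt2_gt1 => s1; have := sqrt2_lt2 => s2.
set a := 2 - s; set b := 2 + s; set r := a / b.
have b_gt0 : 0 < b by rewrite /b; lra.
have cvg_r : r ^+ n @[n --> \oo] --> (0 : R).
  apply: cvg_expr; rewrite ger0_norm; last by rewrite divr_ge0 // /a /b; lra.
  by rewrite ltr_pdivrMr // /a /b; lra.
have -> : (fun n => seq_a R n / seq_t R (n + k)) =
    (fun n => s * (r ^+ n + 1) * (b ^+ k.+1 - a ^+ k.+1 * r ^+ n)^-1).
  apply/funext => n; rewrite /seq_a /seq_t -/s -/a -/b /r expr_div_n.
  have := seq_t_gt0 (n + k); rewrite /seq_t -/s -/a -/b pmulr_lgt0 ?invr_gt0; last lra.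
  rewrite -!addnS !exprD => /lt0r_neq0.
  have : b ^+ n != 0 by rewrite expf_neq0 // gt_eqF.
  move: (a ^+ n) (b ^+ n) (a ^+ k.+1) (b ^+ k.+1) => an bn ak bk bn0 d0.
  by field; rewrite bn0 (mulrC bk) (mulrC ak) d0 gt_eqF // (lt_trans ltr01).
rewrite -[X in _ --> X](_ : s * (0 + 1) * (b ^+ k.+1 - a ^+ k.+1 * 0)^-1 = _); last first.
  by rewrite add0r mulr1 mulr0 subr0.
apply: cvgM.
  by apply: cvgMr; apply: cvgD => //; apply: cvg_cst.
apply: cvgV; first by rewrite mulr0 subr0 expf_neq0 // gt_eqF.
by apply: cvgB; [apply: cvg_cst | apply: cvgMr].
Qed.

End Sequences.

(** * Solution on the tree and limits *)

Lemma tree_balance (R : realType) (n : nat) (v : tree_vertex n) :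
  (degree (@tree_adj n) v).+1%:R * (seq_a R (n - tree_level v) / seq_t R n) =
  (v == tree_root n)%:R +
  \sum_(u | tree_adj u v) seq_a R (n - tree_level u) / seq_t R n.
Proof.
rewrite (sum_tree_adj R n (fun k => seq_a R (n - k) / seq_t R n)) degree_tree.
have t0 m : seq_t R m != 0 by rewrite gt_eqF // seq_t_gt0.
have -> : (v == tree_root n) = (tree_level v == 0)%N.
  by rewrite /tree_level size_eq0.
have : (tree_level v <= n)%N := size_bseq v.
rewrite leq_eqVlt; case: (tree_level v) => [|k] /=.
  (* At the root, level [n = 0] is separate: the single vertex has no neighbours and wins surely. *)
  case: n v t0 => [|n] v t0 _ /=.
    by rewrite seq_a0 seq_t0; lra.
  have := t0 n.+1; rewrite subSS !subn0 !addn0.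
  by rewrite seq_t_eq_a => tn0; field.
case/orP => [/eqP <-|lt_kn].
  (* A leaf below the root has degree 1, and the equation reads 2 a(0) = a(1). *)
  by rewrite ltnn subnn subSnn seq_a0 seq_a1; lra.
rewrite lt_kn.
(* An inner vertex has degree 3; with [m] the height of its children, the equation is the recurrence
   [seq_aSS]. *)
have [m ->] : exists m, n = (m + k.+2)%N by exists (n - k.+2)%N; rewrite subnK.
rewrite addnK.
rewrite (_ : _ - k.+1 = m.+1)%N; last by lia.
rewrite (_ : _ - k = m.+2)%N; last by lia.
have -> : seq_a R m.+2 = 4 * seq_a R m.+1 - 2 * seq_a R m.
  by rewrite -seq_aSS addrK.
by rewrite addn1; have := t0 (m + k.+2)%N => tn0; field.
Qed.

(** The difference of the two sides solves the homogeneous balance equation, so [balanced_eq0] kills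
    it. *)
Lemma win_prob_tree (R : realType) (n : nat) (d : measure_display)
    (Omega : measurableType d) (P : probability Omega R)
    (X : nat -> Omega -> state (tree_vertex n)) (v : tree_vertex n) :
  is_play (@tree_adj n) (tree_root n) P X ->
  win_prob P X v = seq_a R (n - tree_level v) / seq_t R n.
Proof.
move=> play; apply/eqP; rewrite -subr_eq0; apply/eqP; move: v.
apply: (@balanced_eq0 R _ (@tree_adj n)); first exact: tree_adj_sym.
move=> v; rewrite mulrBr tree_balance (win_prob_balance _ _ _ _ _ _ _ _ play).
by rewrite opprD addrACA subrr add0r -sumrB.
Qed.

Theorem mainTheorem4 (R : realType)
    (d : nat -> measure_display) (Omega : forall n : nat, measurableType (d n))
    (P : forall n : nat, probability (Omega n) R)
    (X : forall n : nat, nat -> Omega n -> state (tree_vertex n))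
    (HX : forall n : nat,
      is_play (@tree_adj n) (tree_root n) (P n) (X n)) :
  let p (n : nat) (v : tree_vertex n) : R := win_prob (P n) (X n) v in
  [/\ forall (n k : nat) (v : tree_vertex n),
        (k <= n)%N -> tree_level v = k ->
        p n v = seq_a R (n - k) / seq_t R n,
      forall n : nat,
        p n (tree_root n) = seq_a R n / seq_t R n
        /\ seq_a R n / seq_t R n =
           Num.sqrt 2 * ((2 - Num.sqrt 2) ^+ n + (2 + Num.sqrt 2) ^+ n)
           / ((2 + Num.sqrt 2) ^+ n.+1 - (2 - Num.sqrt 2) ^+ n.+1),
      (fun n : nat => p n (tree_root n)) @ \oo --> (Num.sqrt 2 - 1 : R) &
      forall (k : nat) (v : forall n : nat, tree_vertex n),
        (forall n : nat, (k <= n)%N -> tree_level (v n) = k) ->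
        (fun n : nat => p n (v n)) @ \oo
          --> (Num.sqrt 2 / (2 + Num.sqrt 2) ^+ k.+1 : R)].
Proof.
move=> p; have pE n v : p n v = seq_a R (n - tree_level v) / seq_t R n.
  exact: win_prob_tree.
have cvg_p k (v : forall n, tree_vertex n) :
    (forall n, (k <= n)%N -> tree_level (v n) = k) ->
    p n (v n) @[n --> \oo] --> (Num.sqrt 2 / (2 + Num.sqrt 2) ^+ k.+1 : R).
  (* The level of [v n] is known only from [n = k] on, hence the shift by [k]. *)
  move=> v_level; rewrite -(cvg_shiftn k).
  rewrite (_ : [sequence _]_n = fun n => seq_a R n / seq_t R (n + k)).
    exact: cvg_seq_a_div_t.
  by apply/funext => n /=; rewrite pE v_level ?leq_addl // addnK.
split.
- by move=> n k v _ <-; apply: pE.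
- by move=> n; split; [rewrite pE subn0 | apply: seq_a_div_t].
- rewrite [X in _ --> X](_ : _ = Num.sqrt 2 / (2 + Num.sqrt 2) ^+ 1).
    exact: (cvg_p 0).
  (* With s the square root of 2, (s - 1)(2 + s) = s because s * s = 2. *)
  have := sqr_sqrt2 R; have := sqrt2_gt1 R; rewrite expr1.
  move: (Num.sqrt 2) => s s_gt1 s2.
  have b_neq0 : 2 + s != 0 by rewrite gt_eqF //; lra.
  by apply: (mulIf b_neq0); rewrite divfK //; ring: s2.
- exact: cvg_p.
Qed.
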